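(* Let $p,q\in\mathbb N$ with $p\ge q>1$, let $\varphi$ be the morphism on $\{A,B\}^*$ given by $\varphi(A)=A^pB$, $\varphi(B)=A^q$, let $M_\varphi=\begin{pmatrix}p&1\\ q&0\end{pmatrix}$, let ${\bf u}_\beta=\lim_{m\to\infty}\varphi^m(A)$ be the fixed point of $\varphi$, and let $U_m=|\varphi^m(A)|=(1,0)M_\varphi^m\begin{pmatrix}1\\1\end{pmatrix}$ for $m\ge0$. Let $n\in\mathbb N$ and let $J\in\mathbb N_0$ satisfy $U_J\le n<U_{J+1}$. For integers $m$ write $|v^{(m)}|=1+(q-1)\sum_{i=0}^{m}U_{2i}$ ($m\ge -1$) and $|w^{(m)}|=1+(q-1)\sum_{i=0}^{m-1}U_{2i+1}$ ($m\ge0$), empty sums being $0$. - If $J$ is even: put $N:=\frac J2$, and put $M:=\frac J2$ if $|v^{(J/2)}|\le n$ and $M:=\frac J2-1$ otherwise. - If $J$ is odd: put $M:=\frac{J-1}2$, and put $N:=\frac{J+1}2$ if $|w^{((J+1)/2)}|\le n$ and $N:=\frac{J-1}2$ otherwise. Then the Abelian complexity of ${\bf u}_\beta$ is $$\mathcal{AC}(n)=2+(1,0)\left((q-1)\left[(M_\varphi+I)^{-1}(M_\varphi^{2N}-I)-(M-N+1)M_\varphi^{2N}\right]+\sum_{i=0}^{J}(c_i-d_i)M_\varphi^i\right)\begin{pmatrix}0\\1\end{pmatrix},$$ where the $c_i$, $d_i$ are the digits of the normal $U$-representations $$\langle n-|w^{(N)}|\rangle_U=\Big\langle n-1-(q-1)\sum_{i=0}^{N-1}U_{2i+1}\Big\rangle_U=(c_J,c_{J-1},\ldots,c_1,c_0),$$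 $$\langle n-|v^{(M)}|\rangle_U=\Big\langle n-1-(q-1)\sum_{i=0}^{M}U_{2i}\Big\rangle_U=(d_J,d_{J-1},\ldots,d_1,d_0).$$
   Context: $\mathbb N$ is the set of positive integers and $\mathbb N_0=\mathbb N\cup\{0\}$. For a finite word $w$ over $\{A,B\}$, $|w|$ is its length and $|w|_A,|w|_B$ are the numbers of occurrences of $A$, $B$ in $w$. A factor of an infinite word is a finite block of consecutive letters of it. The Abelian complexity of an infinite word ${\bf u}$ over $\{A,B\}$ is $\mathcal{AC}(n)=\#\{(|w|_A,|w|_B) : w \text{ a factor of } {\bf u} \text{ of length } n\}$. The infinite word ${\bf u}_\beta$ is the infinite word having every $\varphi^m(A)$ as a prefix; it is the unique fixed point of $\varphi$. $I$ is the $2\times2$ identity matrix and $M_\varphi^0=I$. The quantities $|w^{(m)}|$ and $|v^{(m)}|$ for $m\ge0$ are the lengths of the words $w^{(m)},v^{(m)}$ defined by $w^{(0)}=B$, $A^pw^{(m)}=\varphi^2(w^{(m-1)})$ for $m\ge1$, and $v^{(m)}=\varphi(w^{(m)})$ for $m\ge 0$. Normal $U$-representation: given the strictly increasing sequence $U=(U_m)_{m\ge0}$ with $U_0=1$ and an integer $n\ge 0$, choose any $N\in\mathbb N_0$ with $n<U_{N+1}$, put $x_N:=n$, and for $j=N,N-1,\ldots,0$ put $d_j:=\lfloor x_j/U_j\rfloor$ and $x_{j-1}:=x_j-d_jU_j$. Then $\langle n\rangle_U=(d_N,\ldots,d_0)$; leading zeros are permitted (any admissible $N$ may be used), and $n=\sum_{j=0}^N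 d_jU_j$. In particular, $0$ is represented by zeros only. *)

(* Defs.v *)
From HB Require Import structures.
From mathcomp Require Import all_boot all_order all_algebra finmap.
From mathcomp Require Import boolp classical_sets functions cardinality.
From mathcomp Require Import zify.

Set Implicit Arguments.
Unset Strict Implicit.
Unset Printing Implicit Defensive.

Import GRing.Theory.

Inductive letter := A | B.

Definition is_A (x : letter) : bool := if x is A then true else false.
Definition letter_of_bool (b : bool) : letter := if b then A else B.
Lemma is_AK : cancel is_A letter_of_bool. Proof. by case. Qed.

HB.instance Definition _ := Equality.copy letter (can_type is_AK).

Definition phi_letter (p q : nat) (x : letter) : seq letter :=
  match x with A => nseq p A ++ [:: B] | B => nseq q A end.

Definition phi (p q : nat) (w : seq letter) : seq letter :=
  flatten (map (phi_letter p q) w).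

Definition phiA (p q m : nat) : seq letter := iter m (phi p q) [:: A].

(* |phi^i(A)| > i, so the letter of index i can be read off phi^i(A); lemma
   ubeta_prefix below shows that every phi^m(A) is a prefix of this word. *)
Definition ubeta (p q : nat) : nat -> letter := fun i => nth A (phiA p q i) i.

Definition factor (u : nat -> letter) (w : seq letter) : Prop :=
  exists i, w = mkseq (fun j => u (i + j)) (size w).

Definition parikh (w : seq letter) : nat * nat :=
  (count_mem A w, count_mem B w).

Definition parikh_factors (u : nat -> letter) (n : nat) : set (nat * nat) :=
  [set parikh w | w in [set w | factor u w /\ size w = n]]%classic.

(* fset_set is meaningful here by finite_parikh_factors below. *)
Definition abelian_complexity (u : nat -> letter) (n : nat) : nat :=
  #|` fset_set (parikh_factors u n) |%fset.

Definition U (p q m : nat) : nat := size (phiA p q m).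

(* [lenw p q m] is |w^(m)| for m >= 0 and [lenv p q m] is |v^(m)| for m >= -1;
   lemmas size_wword and size_vword below identify them with lengths of words. *)
Definition lenw (p q m : nat) : nat :=
  1 + (q - 1) * \sum_(0 <= i < m) U p q (2 * i + 1).

Definition lenv (p q : nat) (m : int) : nat :=
  1 + (q - 1) * (if m is Posz k then \sum_(0 <= i < k.+1) U p q (2 * i) else 0).

Definition indexN (p q n J : nat) : nat :=
  if odd J then
    if lenw p q (J.+1)./2 <= n then (J.+1)./2 else (J.-1)./2
  else J./2.

Definition indexM (p q n J : nat) : int :=
  if odd J then Posz (J.-1)./2
  else if lenv p q (Posz J./2) <= n then Posz J./2 else (Posz J./2 - 1)%R.

(* The list (d_K, ..., d_0) produced by the greedy algorithm started at
   x_K := x; it is the normal representation of x when x < V K.+1. *)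
Fixpoint normal_rep (V : nat -> nat) (K x : nat) : seq nat :=
  let d := x %/ V K in
  d :: (if K is K'.+1 then normal_rep V K' (x - d * V K) else [::]).

Definition digit (V : nat -> nat) (K x i : nat) : nat :=
  nth 0 (normal_rep V K x) (K - i).

Definition mx22 (a b c d : rat) : 'M[rat]_2 :=
  \matrix_(i < 2, j < 2) ((nth [::] [:: [:: a; b]; [:: c; d]] i)`_j)%R.

Definition row2 (a b : rat) : 'rV[rat]_2 := \row_(j < 2) ([:: a; b]`_j)%R.

Definition col2 (a b : rat) : 'cV[rat]_2 := \col_(i < 2) ([:: a; b]`_i)%R.

Definition Mphi (p q : nat) : 'M[rat]_2 := mx22 p%:R 1 q%:R 0.

Fixpoint wword (p q m : nat) : seq letter :=
  if m is k.+1 then drop p (phi p q (phi p q (wword p q k))) else [:: B].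

Definition vword (p q m : nat) : seq letter := phi p q (wword p q m).

Section Facts.
Variables p q : nat.

Lemma finite_parikh_factors u n : finite_set (parikh_factors u n).
Proof.
apply: (@sub_finite_set _ _
  [set` [seq (i, j) | i <- iota 0 n.+1, j <- iota 0 n.+1]]%classic);
  last exact: finite_seq.
move=> _ [w [_ wn] <-]; change (is_true (parikh w \in
  [seq (i, j) | i <- iota 0 n.+1, j <- iota 0 n.+1])).
by apply: allpairs_f; rewrite mem_iota add0n ltnS -wn count_size.
Qed.

Lemma phi_cat s t : phi p q (s ++ t) = phi p q s ++ phi p q t.
Proof. by rewrite /phi map_cat flatten_cat. Qed.

Lemma count_phi w : (count_mem A (phi p q w) = p * count_mem A w + q * count_mem B w)
  * (count_mem B (phi p q w) = count_mem A w).
Proof.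
elim: w => [|x w [IA IB]]; first by rewrite !muln0.
rewrite /phi /= -/(phi p q w) !count_cat IA IB.
by case: x; rewrite /= ?count_cat !count_nseq /=; split; lia.
Qed.

Lemma size_count w : size w = count_mem A w + count_mem B w.
Proof. by elim: w => //= -[] w ->; rewrite /=; lia. Qed.

Lemma U_rec m : U p q m.+2 = p * U p q m.+1 + q * U p q m.
Proof. by rewrite /U /phiA !iterS !size_count !count_phi; lia. Qed.

Lemma U0 : U p q 0 = 1. Proof. by []. Qed.
Lemma U1 : U p q 1 = p.+1.
Proof. by rewrite /U /phiA /phi /= cats0 size_cat size_nseq addn1. Qed.

Lemma U_mx m :
  ((U p q m)%:R)%R = ((row2 1 0 *m Mphi p q ^+ m *m col2 1 1) 0 0)%R :> rat.
Proof.
have -> : (row2 1 0 *m Mphi p q ^+ m)%R =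
    row2 (count_mem A (phiA p q m))%:R%R (count_mem B (phiA p q m))%:R%R.
  elim: m => [|m IH]; first by rewrite expr0 mulmx1.
  rewrite exprSr mulmxA IH; apply/rowP => j; rewrite /phiA iterS !count_phi.
  rewrite !mxE !big_ord_recl big_ord0 !mxE /=.
  case: j => -[|[|//]] ? /=; rewrite addr0 ?mulr1 ?mulr0 ?addr0 //.
  by rewrite natrD !natrM; congr (_ + _)%R; rewrite mulrC.
by rewrite /U size_count !mxE !big_ord_recl big_ord0 !mxE /= !mulr1 addr0 natrD.
Qed.

Hypothesis p_gt0 : 0 < p.

Lemma phiA_prefixS m : exists t, phiA p q m.+1 = phiA p q m ++ t.
Proof.
elim: m => [|m [t IH]]; last first.
  by exists (phi p q t); rewrite [LHS](congr1 (phi p q) IH) phi_cat.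
by case: p p_gt0 => // k _; exists (nseq k A ++ [:: B]); rewrite /phiA /phi /= cats0.
Qed.

Lemma phiA_prefix m k : exists t, phiA p q (m + k) = phiA p q m ++ t.
Proof.
elim: k => [|k [t IH]]; first by exists [::]; rewrite addn0 cats0.
by have [s] := phiA_prefixS (m + k); rewrite addnS IH -catA => ->; exists (t ++ s).
Qed.

Hypothesis q_gt0 : 0 < q.

Lemma U_lt m : U p q m < U p q m.+1.
Proof.
suff /andP[] : 0 < U p q m < U p q m.+1 by [].
elim: m => [|m /andP[IH0 IH]]; first by rewrite U1.
by rewrite (leq_trans _ IH) // U_rec; nia.
Qed.

Lemma U_gt m : m < U p q m.
Proof. by elim: m => // m IH; have := U_lt m; lia. Qed.

Lemma ubeta_prefix m : mkseq (ubeta p q) (size (phiA p q m)) = phiA p q m.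
Proof.
apply: (@eq_from_nth _ A); rewrite size_mkseq // => i im.
rewrite nth_mkseq // /ubeta.
have im' : i < size (phiA p q i) by exact: U_gt.
have [le_im|/ltnW le_mi] := leqP i m.
  by have [t] := phiA_prefix i (m - i); rewrite subnKC // => ->; rewrite nth_cat im'.
by have [t] := phiA_prefix m (i - m); rewrite subnKC // => ->; rewrite nth_cat im.
Qed.

Lemma wwordS m : phi p q (phi p q (wword p q m)) = nseq p A ++ wword p q m.+1.
Proof.
suff [t e] : exists t, phi p q (phi p q (wword p q m)) = nseq p A ++ B :: t.
  by rewrite /= e drop_size_cat // size_nseq.
have phi2B s : exists t, phi p q (phi p q (B :: s)) = nseq p A ++ B :: t.
  case: q q_gt0 => // k _; eexists.
  by rewrite /phi /= -catA /=; reflexivity.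
suff [s ->] : exists s, wword p q m = B :: s by exact: phi2B.
elim: m => [|m [s IH]]; first by exists [::].
by have [t e] := phi2B s; exists t; rewrite /= IH e drop_size_cat // size_nseq.
Qed.

Lemma count_phiA_shift m :
  (\sum_(0 <= i < m.+1) count_mem A (phiA p q (2 * i + 1)) =
    p + (p * (p * (\sum_(0 <= i < m) count_mem A (phiA p q (2 * i + 1)))
              + q * (\sum_(0 <= i < m) count_mem B (phiA p q (2 * i + 1))))
         + q * (\sum_(0 <= i < m) count_mem A (phiA p q (2 * i + 1)))))
  * (\sum_(0 <= i < m.+1) count_mem B (phiA p q (2 * i + 1)) =
    1 + (p * (\sum_(0 <= i < m) count_mem A (phiA p q (2 * i + 1)))
         + q * (\sum_(0 <= i < m) count_mem B (phiA p q (2 * i + 1))))).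
Proof.
have step i : phiA p q (2 * i.+1 + 1) = phi p q (phi p q (phiA p q (2 * i + 1))).
  by have -> : 2 * i.+1 + 1 = (2 * i + 1).+2 by lia.
elim: m => [|m [IA IB]].
  by rewrite !big_nat1 !big_nil /phiA /= !count_phi /= !(addn0, muln0, muln1).
split.
  by rewrite [LHS]big_nat_recr // [in LHS]IA step !count_phi !(big_nat_recr m) //=; lia.
by rewrite [LHS]big_nat_recr // [in LHS]IB step !count_phi !(big_nat_recr m) //=; lia.
Qed.

Lemma count_wword m :
  (count_mem A (wword p q m) =
    (q - 1) * \sum_(0 <= i < m) count_mem A (phiA p q (2 * i + 1)))
  * (count_mem B (wword p q m) =
    1 + (q - 1) * \sum_(0 <= i < m) count_mem B (phiA p q (2 * i + 1))).
Proof.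
elim: m => [|m [IA IB]]; first by rewrite !big_nil !muln0.
have eA := congr1 (count_mem A) (wwordS m).
have eB := congr1 (count_mem B) (wwordS m).
rewrite !count_phi IA IB count_cat count_nseq [X in X * p]/= mul1n in eA.
rewrite !count_phi IA IB count_cat count_nseq [X in X * p]/= mul0n add0n in eB.
rewrite !count_phiA_shift.
move: eA eB; set a := count_mem A _; set b := count_mem B _.
set s := \sum_(0 <= i < m) count_mem A _; set t := \sum_(0 <= i < m) count_mem B _.
case: q q_gt0 => // k _; rewrite subSS subn0 => eA eB; split; lia.
Qed.

Lemma size_wword m : size (wword p q m) = lenw p q m.
Proof.
rewrite size_count !count_wword /lenw addnCA -mulnDr -big_split /=.
by congr (_ + _ * _); apply: eq_bigr => i _; rewrite -size_count.
Qed.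

Lemma size_vword m : size (vword p q m) = lenv p q (Posz m).
Proof.
rewrite /lenv big_nat_recl // U0 size_count !count_phi !count_wword.
have -> : \sum_(0 <= i < m) U p q (2 * i.+1) =
    p * (\sum_(0 <= i < m) count_mem A (phiA p q (2 * i + 1)))
    + q * (\sum_(0 <= i < m) count_mem B (phiA p q (2 * i + 1)))
    + \sum_(0 <= i < m) count_mem A (phiA p q (2 * i + 1)).
  rewrite !big_distrr -!big_split /=; apply: eq_bigr => i _.
  have -> : 2 * i.+1 = (2 * i + 1).+1 by lia.
  by rewrite /U /phiA iterS size_count !count_phi.
set s := \sum_(0 <= i < m) count_mem A _; set t := \sum_(0 <= i < m) count_mem B _.
by case: q q_gt0 => // k _; rewrite subSS subn0; nia.
Qed.

Lemma lenw_le m : q <= p -> lenw p q m <= U p q (2 * m).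
Proof.
move=> qp; rewrite /lenw; elim: m => [|m IH]; first by rewrite big_nil muln0.
rewrite big_nat_recr //=; have -> : 2 * m.+1 = (2 * m).+2 by lia.
by rewrite U_rec addn1; nia.
Qed.

Lemma lenv_le m : q <= p -> lenv p q (Posz m) <= U p q (2 * m).+1.
Proof.
move=> qp; rewrite /lenv; elim: m => [|m IH]; first by rewrite big_nat1 U0 U1; lia.
rewrite big_nat_recr //=; have -> : 2 * m.+1 = (2 * m).+2 by lia.
by rewrite (U_rec (2 * m).+1); nia.
Qed.

(* The subtractions n - |w^(N)| and n - |v^(M)| are never truncated. *)
Lemma lenw_indexN n J : q <= p -> U p q J <= n -> lenw p q (indexN p q n J) <= n.
Proof.
move=> qp Jn; rewrite /indexN; have := odd_double_half J.
case: (odd J) => /= eJ.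
  case: ifP => // _; apply: leq_trans (lenw_le _ qp) (leq_trans _ Jn).
  have := U_lt (2 * (J.-1)./2).
  have <- : J = (2 * (J.-1)./2).+1 by lia.
  exact: ltnW.
apply: leq_trans (lenw_le _ qp) (leq_trans _ Jn).
have -> : 2 * J./2 = J by lia.
exact: leqnn.
Qed.

Lemma lenv_indexM n J :
  0 < n -> q <= p -> U p q J <= n -> lenv p q (indexM p q n J) <= n.
Proof.
move=> n_gt0 qp Jn; rewrite /indexM; have := odd_double_half J.
case: (odd J) => /= eJ.
  apply: leq_trans (lenv_le _ qp) (leq_trans _ Jn).
  have <- : J = (2 * (J.-1)./2).+1 by lia.
  exact: leqnn.
case: ifP => // _; case: (J./2) eJ => [|k] eJ; first by rewrite /lenv /= muln0.
have -> : (Posz k.+1 - 1)%R = Posz k by lia.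
apply: leq_trans (lenv_le _ qp) (leq_trans _ Jn).
by rewrite -eJ add0n doubleS -mul2n ltnW // U_lt.
Qed.

Lemma Mphi_add1_unit : q <= p -> (Mphi p q + 1%:M)%R \in unitmx.
Proof.
move=> qp; rewrite unitmxE (expand_det_row _ 0%R) !big_ord_recl big_ord0.
rewrite /cofactor !det_mx11 !mxE /= unitfE.
rewrite /bump /= expr0 expr1 !addr0 add0r !mul1r mulr1 mulN1r natr1.
have qp1 : q <= p.+1 by exact: leqW.
by rewrite -natrB // Num.Theory.pnatr_eq0 subn_eq0 -ltnNge ltnS.
Qed.

End Facts.

Lemma normal_rep_sum (V : nat -> nat) (K x : nat) :
  V 0 = 1 -> x = \sum_(i < K.+1) digit V K x i * V i.
Proof.
move=> V0; elim: K x => [|K IH] x.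
  by rewrite big_ord1 /digit /= V0 divn1 muln1.
rewrite big_ord_recr /= {2}/digit subnn /=.
rewrite -[LHS](subnK (leq_trunc_div x (V K.+1))); congr (_ + _).
rewrite [LHS]IH; apply: eq_bigr => i _.
by rewrite /digit subSn // -ltnS.
Qed.

(* Main.v *)
From HB Require Import structures.
Require Import Defs.
From mathcomp Require Import all_boot all_order all_algebra finmap.
From mathcomp Require Import classical_sets cardinality.
From mathcomp Require Import zify ring.

(* Let W = lim w^(m) and V = lim v^(m), with v^(-1) = A; then phi(W) = V and
   phi(V) = A^p W.  Among the factors of length n the prefix of W has the most
   B's and the prefix of V the fewest.  Indeed the number of B's in a prefix of
   an image phi(f) is the number of A's in the corresponding prefix of f, so a
   factor with too many (too few) B's desubstitutes to a shorter factor with too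
   few (too many) B's.  The number of B's changes by at most one when the window
   slides by one letter, so AC(n) - 1 is the difference of the two extremes.
   Since w^(m+1) = w^(m) phi^(2m+1)(A)^(q-1) and v^(m) = v^(m-1) phi^(2m)(A)^(q-1),
   the two extremal words are w^(N) and v^(M) followed by prefixes of u_beta, and
   the letters of these prefixes are counted by the normal U-representation. *)

Set Implicit Arguments.
Unset Strict Implicit.
Unset Printing Implicit Defensive.

Import GRing.Theory.

(** * Prefixes of infinite words *)

Definition initial (x : seq letter) (f : nat -> letter) : Prop :=
  mkseq f (size x) = x.

Definition cA (f : nat -> letter) (n : nat) : nat := count_mem A (mkseq f n).
Definition cB (f : nat -> letter) (n : nat) : nat := count_mem B (mkseq f n).

Definition prepend (x : seq letter) (f : nat -> letter) : nat -> letter :=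
  fun i => if i < size x then nth A x i else f (i - size x).

(** [g] is the image of [f] under the morphism, stated through finite prefixes because [phi] acts on
    finite words only. *)
Definition image (p q : nat) (f g : nat -> letter) : Prop :=
  forall k, initial (phi p q (mkseq f k)) g.

Lemma take_mkseq (T : Type) (f : nat -> T) k n :
  k <= n -> take k (mkseq f n) = mkseq f k.
Proof. by move=> kn; rewrite /mkseq -map_take take_iota (minn_idPl kn). Qed.

Lemma mkseqD (T : Type) (f : nat -> T) m n :
  mkseq f (m + n) = mkseq f m ++ mkseq (fun j => f (m + j)) n.
Proof.
rewrite /mkseq iotaD map_cat; congr (_ ++ _).
by rewrite add0n -[m in iota m]addn0 iotaDl -map_comp.
Qed.

Lemma initial_mkseq x f k : initial x f -> k <= size x -> mkseq f k = take k x.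
Proof. by move=> <- kx; rewrite size_mkseq in kx *; rewrite take_mkseq. Qed.

Lemma initial_catl x y f : initial (x ++ y) f -> initial x f.
Proof.
move=> xyf; rewrite /initial (initial_mkseq xyf) ?take_size_cat //.
by rewrite size_cat leq_addr.
Qed.

Lemma cAB f n : cA f n + cB f n = n.
Proof. by rewrite /cA /cB -size_count size_mkseq. Qed.

Lemma cB_addn f m n : cB f (m + n) = cB f m + cB (fun j => f (m + j)) n.
Proof. by rewrite /cB mkseqD count_cat. Qed.

Lemma cA_addn f m n : cA f (m + n) = cA f m + cA (fun j => f (m + j)) n.
Proof. by rewrite /cA mkseqD count_cat. Qed.

Lemma cAS f n : cA f n.+1 = cA f n + is_A (f n).
Proof. by rewrite -addn1 cA_addn {2}/cA /= !addn0; case: (f n). Qed.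

Lemma cBS f n : cB f n.+1 = cB f n + ~~ is_A (f n).
Proof. by rewrite -addn1 cB_addn {2}/cB /= !addn0; case: (f n). Qed.

Lemma leq_cB f m n : m <= n -> cB f m <= cB f n.
Proof. by move=> /subnKC <-; rewrite cB_addn leq_addr. Qed.

Lemma leq_cA f m n : m <= n -> cA f m <= cA f n.
Proof. by move=> /subnKC <-; rewrite cA_addn leq_addr. Qed.

Lemma mkseq_prepend x f n :
  mkseq (prepend x f) (size x + n) = x ++ mkseq f n.
Proof.
rewrite mkseqD; congr (_ ++ _).
  apply: (@eq_from_nth _ A); rewrite size_mkseq // => i ix.
  by rewrite nth_mkseq // /prepend ix.
apply: eq_mkseq => j; rewrite /prepend ltnNge leq_addr /=; congr f; lia.
Qed.

Lemma initial_prepend a x f : initial x f -> initial (a ++ x) (prepend a f).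
Proof. by rewrite /initial size_cat mkseq_prepend => ->. Qed.

(** By the chain condition [s i] and [s m] agree on their common positions, and [s i] is long enough
    to have a letter of index [i]. *)
Lemma initial_limit (s : nat -> seq letter) m :
    (forall k, exists t, s k.+1 = s k ++ t) -> (forall k, k < size (s k)) ->
  initial (s m) (fun i => nth A (s i) i).
Proof.
move=> s_chain s_size.
have s_cat i k : exists t, s (i + k) = s i ++ t.
  elim: k => [|k [t IH]]; first by exists [::]; rewrite addn0 cats0.
  by have [r] := s_chain (i + k); rewrite IH -catA addnS => ->; exists (t ++ r).
apply: (@eq_from_nth _ A); rewrite size_mkseq // => i im.
rewrite nth_mkseq //.
have [le_im|/ltnW le_mi] := leqP i m.
  by have [t] := s_cat i (m - i); rewrite subnKC // => ->; rewrite nth_cat s_size.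
by have [t] := s_cat m (i - m); rewrite subnKC // => ->; rewrite nth_cat im.
Qed.

Lemma image_limit p q (s : nat -> seq letter) f g :
    (forall m, m < size (s m)) -> (forall m, initial (s m) f) ->
    (forall m, initial (phi p q (s m)) g) ->
  image p q f g.
Proof.
move=> s_size sf sg k.
have := sg k; rewrite -[s k](cat_take_drop k).
rewrite -(initial_mkseq (sf k)) ?(ltnW (s_size k)) //.
by rewrite phi_cat; exact: initial_catl.
Qed.

(** * Desubstitution *)

Lemma size_phi p q x :
  size (phi p q x) = p.+1 * count_mem A x + q * count_mem B x.
Proof. by rewrite size_count !count_phi; lia. Qed.

(* A letter of f contributes a B to the image exactly when it is an A, and
   that B is the last letter of its block. *)
Lemma cB_image p q f g i : 0 < q -> image p q f g ->
  exists k, [/\ p.+1 * cA f k + q * cB f k <= i,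
    i < p.+1 * cA f k.+1 + q * cB f k.+1 & cB g i = cA f k].
Proof.
move=> q_gt0 fg.
pose P k := p.+1 * cA f k + q * cB f k.
have PE k : P k = size (phi p q (mkseq f k)) by rewrite size_phi.
have exP : exists k, i < P k.
  by exists i.+1; rewrite /P; have := cAB f i.+1; nia.
(* The least length whose image exceeds [i] is [k.+1], so position [i] lies in the block of the
   letter [f k]. *)
case: (ex_minnP exP) => -[|k] iP kmin; first by rewrite /P /cA /cB /= !muln0 in iP.
have Pi : P k <= i by rewrite leqNgt; apply/negP => /kmin; rewrite ltnn.
exists k; split=> //.
have e : phi p q (mkseq f k.+1) = phi p q (mkseq f k) ++ phi_letter p q (f k).
  by rewrite -addn1 mkseqD phi_cat /phi /= addn0 cats0.
rewrite /cB (initial_mkseq (fg k.+1)) -?PE ?(ltnW iP) // e take_cat -PE ltnNge Pi /=.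
rewrite count_cat count_phi -/(cA f k).
rewrite -[RHS]addn0; congr (_ + _).
have : i - P k < size (phi_letter p q (f k)).
  by move: iP; rewrite !PE e size_cat; rewrite PE in Pi; lia.
case: (f k) => /=; last first.
  by rewrite size_nseq => lt; rewrite take_nseq ?count_nseq // ltnW.
rewrite size_cat size_nseq addn1 ltnS => lt.
by rewrite takel_cat ?size_nseq // take_nseq // count_nseq.
Qed.

(** Strong induction on [n], following the ends of the window and of the prefixes of [v] and [w]
    back through the morphism. A bound on the B's of the shorter factor bounds its A's the other way
    round, which exchanges the roles of [w] and [v]. *)
Lemma cB_factor_bounds p q (u w v : nat -> letter) :
    1 < q -> q <= p ->
    image p q u u -> image p q w v -> image p q v (prepend (nseq p A) w) ->
    w 0 = B -> v 0 = A ->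
  forall n i, cB u i + cB v n <= cB u (i + n) <= cB u i + cB w n.
Proof.
move=> q_gt1 qp uu wv vw w0 v0 n.
elim/ltn_ind: n => n IH i.
have q_gt0 : 0 < q by lia.
(* Length 1 is a base case too: desubstitution need not shorten a one-letter factor. *)
case: n IH => [|[|n]] IH; first by rewrite addn0 /cB /= !addn0 !leqnn.
  rewrite cB_addn /cB /= w0 v0 addn0; case: (u _) => //=; lia.
have [k [Pk kP ->]] := cB_image i q_gt0 uu.
have [l [Pl lP ->]] := cB_image (i + n.+2) q_gt0 uu.
have mono a b : a <= b -> p.+1 * cA u a + q * cB u a <= p.+1 * cA u b + q * cB u b.
  by move=> ab; rewrite leq_add // leq_mul2l ?leq_cA ?leq_cB ?orbT.
have kl : k <= l by rewrite leqNgt; apply/negP => /mono; lia.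
(* Blocks strictly between the two cut ones have at least two letters, as [1 < q]. *)
have m_lt : l - k < n.+2.
  have := cAB u l; have := cAB u k.+1.
  have [->|lk] := eqVneq l k; first by lia.
  have kl' : k.+1 <= l by rewrite ltn_neqAle eq_sym lk.
  move: Pl; rewrite -(subnK (leq_cA u kl')) -(subnK (leq_cB u kl')).
  set a := cA u l - _; set b := cB u l - _.
  have : 2 * a <= p.+1 * a by rewrite leq_mul2r; lia.
  have : 2 * b <= q * b by rewrite leq_mul2r q_gt1 orbT.
  lia.
have {IH} := IH _ m_lt k; rewrite subnKC // => /andP[].
have := cAB u k; have := cAB u l.
move: Pl lP; rewrite (cAS u) (cBS u).
rewrite -(subnK (leq_cA u kl)) -(subnK (leq_cB u kl)).
set a := cA u l - _; set b := cB u l - _; set m := l - k in m_lt *.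
move=> Pl lP lE kE lowB upB.
apply/andP; split.
  (* Too many B's in [v] give [j] letters of [w] with more than [a] A's. For length reasons fewer
     than [b] of them are B's, so [j < m], and [upB] then allows at most [a] A's. *)
  have [j [Pj jP ->]] := cB_image n.+2 q_gt0 wv.
  rewrite addnC leq_add2r leqNgt; apply/negP => lt.
  have jB : cB w j < b.
    rewrite ltnNge; apply/negP => bj.
    have : q * b <= q * cB w j by rewrite leq_mul2l bj orbT.
    have : p.+1 * a.+1 <= p.+1 * cA w j by rewrite leq_mul2l lt orbT.
    by move: lP; case: (u l) => /=; lia.
  have jm : j < m by rewrite ltnNge; apply/negP => /(leq_cB w); lia.
  have := leq_cA w (ltnW jm); have := cAB w m; lia.
(* The window may start up to [p] letters inside the block of [u k]; the [p] prepended A's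
   compensate for this without changing the number of B's. *)
have -> : cB w n.+2 = cB (prepend (nseq p A) w) (p + n.+2).
  rewrite /cB; have := mkseq_prepend (nseq p A) w n.+2; rewrite size_nseq => ->.
  by rewrite count_cat count_nseq.
have [j [Pj jP ->]] := cB_image (p + n.+2) q_gt0 vw.
rewrite addnC leq_add2l leqNgt; apply/negP => lt.
have [mj|jm] := leqP m j.
  by have := leq_cA v mj; have := cAB v m; lia.
have Bb : cB v j.+1 <= b by apply: leq_trans (leq_cB v jm) _; lia.
have Aa : cA v j.+1 <= a by rewrite cAS; case: (v j); lia.
have : q * cB v j.+1 <= q * b by rewrite leq_mul2l Bb orbT.
have : p.+1 * cA v j.+1 <= p.+1 * a by rewrite leq_mul2l Aa orbT.
by move: kP; rewrite cAS cBS; case: (u k) => /=; lia.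
Qed.

(** * The extremal words *)

Definition rep (x : seq letter) (j : nat) : seq letter := flatten (nseq j x).

Lemma repS x j : rep x j.+1 = rep x j ++ x.
Proof. by rewrite /rep -addn1 nseqD flatten_cat /= cats0. Qed.

Lemma size_rep x j : size (rep x j) = j * size x.
Proof. by elim: j => // j IH; rewrite repS size_cat IH; lia. Qed.

Lemma count_rep a x j : count a (rep x j) = j * count a x.
Proof. by elim: j => // j IH; rewrite repS count_cat IH; lia. Qed.

Lemma rep_seq1 a j : rep [:: a] j = nseq j a.
Proof. by rewrite /rep; elim: j => //= j ->. Qed.

Lemma phi_rep p q x j : phi p q (rep x j) = rep (phi p q x) j.
Proof. by elim: j => // j IH; rewrite !repS phi_cat IH. Qed.

Lemma iter_phi_rep p q k x j :
  iter k (phi p q) (rep x j) = rep (iter k (phi p q) x) j.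
Proof. by elim: k => //= k ->; rewrite phi_rep. Qed.

Lemma iter_phi_cat p q k x y :
  iter k (phi p q) (x ++ y) = iter k (phi p q) x ++ iter k (phi p q) y.
Proof. by elim: k => //= k ->; rewrite phi_cat. Qed.

Lemma phi1A p q : phi p q [:: A] = nseq p A ++ [:: B].
Proof. exact: cats0. Qed.

Lemma phi1B p q : phi p q [:: B] = nseq q A.
Proof. exact: cats0. Qed.

Lemma phiAS p q k :
  phiA p q k.+1 = rep (phiA p q k) p ++ iter k (phi p q) [:: B].
Proof.
by rewrite /phiA iterSr phi1A iter_phi_cat -rep_seq1 iter_phi_rep.
Qed.

Lemma iter_phi_B p q k : iter k.+1 (phi p q) [:: B] = rep (phiA p q k) q.
Proof. by rewrite iterSr phi1B -rep_seq1 iter_phi_rep. Qed.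

Lemma initial_rep p q k j :
  0 < p -> 0 < q -> j <= p -> initial (rep (phiA p q k) j) (ubeta p q).
Proof.
move=> p_gt0 q_gt0 jp; have := ubeta_prefix p_gt0 q_gt0 k.+1.
rewrite -/(initial _ _) phiAS -(subnKC jp) /rep nseqD flatten_cat -catA.
exact: initial_catl.
Qed.

(** One greedy step. After fewer than [p] copies of [phi^k(A)] another copy follows; after [p]
    copies comes [phi^k(B)], which for [k > 0] is the [q]-th power of [phi^(k-1)(A)], again a prefix
    of [ubeta] since [q <= p]. *)
Lemma mkseq_ubeta p q k d x : 0 < q -> q <= p -> d <= p ->
    x < U p q k -> d * U p q k + x < U p q k.+1 ->
  mkseq (ubeta p q) (d * U p q k + x) =
    rep (phiA p q k) d ++ mkseq (ubeta p q) x.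
Proof.
move=> q_gt0 qp dp xk dxk; have p_gt0 : 0 < p by lia.
have mkseq_take y z : initial (y ++ z) (ubeta p q) ->
    x <= size z -> mkseq (ubeta p q) x = take x z ->
    mkseq (ubeta p q) (size y + x) = y ++ mkseq (ubeta p q) x.
  move=> yz xz ->; rewrite (initial_mkseq yz) ?size_cat ?leq_add2l //.
  by rewrite take_cat ltnNge leq_addr /= addKn.
have phiAu j : initial (phiA p q j) (ubeta p q) := ubeta_prefix p_gt0 q_gt0 j.
rewrite -[U p q k]/(size (phiA p q k)) -size_rep in dxk *.
have [dp'|pd] := ltnP d p.
  apply: (mkseq_take _ (phiA p q k)); rewrite ?(ltnW xk) //.
    by rewrite -repS; exact: initial_rep.
  by rewrite (initial_mkseq (phiAu k)) // ltnW.
have {pd dp}de : d = p by lia.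
rewrite {}de in dxk *.
move: dxk; rewrite /U phiAS size_cat ltn_add2l => /ltnW xz.
apply: (mkseq_take _ (iter k (phi p q) [:: B])) => //; first by rewrite -phiAS.
(* For [k = 0] the next letter is B, which does not begin [ubeta], but then [x = 0]. *)
case: k xk xz => [|k] xk xz; first by have -> : x = 0 by move: xk; rewrite U0; lia.
rewrite iter_phi_B in xz *; apply: initial_mkseq xz; exact: initial_rep.
Qed.

(* The index is shifted by one: [init_v p q m] is v^(m-1). *)
Definition init_v (p q m : nat) : seq letter :=
  if m is k.+1 then vword p q k else [:: A].

(** The diagonal reading is sound when [0 < p] and [1 < q]: each word of the chain is then longer
    than its index. *)
Definition wlim (p q : nat) : nat -> letter := fun i => nth A (wword p q i) i.
Definition vlim (p q : nat) : nat -> letter := fun i => nth A (init_v p q i) i.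

(** The prefix [A^p] of [phi^2(w^(m))] is cancelled, and [phi^2] raises the exponent of the appended
    block by 2. The base case is [(A^p B)^q = A^p B (A^p B)^(q-1)]. *)
Lemma wwordE p q m : 0 < q ->
  wword p q m.+1 = wword p q m ++ rep (phiA p q (2 * m + 1)) (q - 1).
Proof.
move=> q_gt0.
have cancelA x y : nseq p A ++ x = nseq p A ++ y -> x = y.
  by move=> /(congr1 (drop (size (nseq p A)))); rewrite !drop_size_cat.
elim: m => [|m IH]; apply: cancelA; rewrite -wwordS //.
  rewrite phi1B -rep_seq1 phi_rep phi1A -[in LHS](subnKC q_gt0) /rep nseqD.
  by rewrite flatten_cat /= cats0 -catA /phiA /= phi1A.
rewrite [in LHS]IH phi_cat phi_cat wwordS // !phi_rep -catA.
by have -> : 2 * m.+1 + 1 = (2 * m + 1).+2 by lia.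
Qed.

Lemma init_vE p q m : 0 < q ->
  init_v p q m.+1 = init_v p q m ++ rep (phiA p q (2 * m)) (q - 1).
Proof.
move=> q_gt0; case: m => [|m].
  by rewrite [LHS]phi1B rep_seq1 -[in LHS](subnKC q_gt0) nseqD.
rewrite [LHS](congr1 (phi p q) (wwordE p m q_gt0)) phi_cat phi_rep.
by have -> : 2 * m.+1 = (2 * m + 1).+1 by lia.
Qed.

(** The offset [e] serves both chains at once: it is 1 for [wword] and 0 for [init_v]. *)
Lemma size_chain p q e (s : nat -> seq letter) m : 0 < p -> 1 < q ->
    size (s 0) = 1 ->
    (forall m, s m.+1 = s m ++ rep (phiA p q (2 * m + e)) (q - 1)) ->
  m < size (s m).
Proof.
move=> p_gt0 q_gt1 s0 sE; elim: m => [|m IH]; first by rewrite s0.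
rewrite sE size_cat size_rep.
have := U_gt p_gt0 (ltnW q_gt1) (2 * m + e); rewrite /U; nia.
Qed.

(** What follows [s m] lies in a power of [phi^(2m+e)(A)] with exponent [q - 1 < p], itself a prefix
    of [ubeta]. *)
Lemma mkseq_chain p q e (s : nat -> seq letter) f n m : 0 < q -> q <= p ->
    (forall m, initial (s m) f) ->
    (forall m, s m.+1 = s m ++ rep (phiA p q (2 * m + e)) (q - 1)) ->
    size (s m) <= n < size (s m.+1) ->
  mkseq f n = s m ++ mkseq (ubeta p q) (n - size (s m)).
Proof.
move=> q_gt0 qp sf sE /andP[mn nm].
rewrite (initial_mkseq (sf m.+1) (ltnW nm)) sE take_cat ltnNge mn /=.
congr (_ ++ _); apply/esym/initial_mkseq; first by apply: initial_rep; lia.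
by move: nm; rewrite sE size_cat; lia.
Qed.

Lemma count_chain p q e (s : nat -> seq letter) a m :
    (forall m, s m.+1 = s m ++ rep (phiA p q (2 * m + e)) (q - 1)) ->
  count a (s m) =
    count a (s 0) + (q - 1) * \sum_(0 <= i < m) count a (phiA p q (2 * i + e)).
Proof.
move=> sE; elim: m => [|m IH]; first by rewrite big_nil muln0 addn0.
by rewrite sE count_cat IH count_rep big_nat_recr //= mulnDr addnA.
Qed.

(** * Factors of [ubeta] and images of the limit words *)

Lemma factorP u x : factor u x <-> exists y, initial (y ++ x) u.
Proof.
split=> [[i ->]|[y yx]].
  exists (mkseq u i); rewrite /initial size_cat !size_mkseq mkseqD.
  by congr (_ ++ _); rewrite size_mkseq.
exists (size y); move: yx; rewrite /initial size_cat mkseqD => /eqP.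
by rewrite eqseq_cat ?size_mkseq // => /andP[_ /eqP].
Qed.

Lemma factor_catr u x y : factor u (x ++ y) -> factor u y.
Proof. by move=> /factorP[z zu]; apply/factorP; exists (z ++ x); rewrite -catA. Qed.

Lemma factor_catl u x y : factor u (x ++ y) -> factor u x.
Proof.
move=> /factorP[z zu]; apply/factorP; exists z.
by apply: (initial_catl (y := y)); rewrite -catA.
Qed.

Lemma factor_phi p q u x : image p q u u -> factor u x -> factor u (phi p q x).
Proof.
move=> uu /factorP[y yx]; apply/factorP; exists (phi p q y).
by rewrite -phi_cat -yx; exact: uu.
Qed.

Lemma image_ubeta p q : 0 < p -> 0 < q -> image p q (ubeta p q) (ubeta p q).
Proof.
move=> p_gt0 q_gt0; apply: (@image_limit _ _ (phiA p q)) => m.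
- exact: U_gt.
- exact: ubeta_prefix.
- exact: (ubeta_prefix p_gt0 q_gt0 m.+1).
Qed.

Lemma initial_wlim p q m : 0 < p -> 1 < q -> initial (wword p q m) (wlim p q).
Proof.
move=> p_gt0 q_gt1; have wE k := wwordE p k (ltnW q_gt1).
apply: initial_limit => k; first by eexists; exact: wE.
exact: size_chain wE.
Qed.

Lemma initial_vlim p q m : 0 < p -> 1 < q -> initial (init_v p q m) (vlim p q).
Proof.
move=> p_gt0 q_gt1.
have vE k : init_v p q k.+1 = init_v p q k ++ rep (phiA p q (2 * k + 0)) (q - 1).
  by rewrite addn0; exact: init_vE (ltnW q_gt1).
apply: initial_limit => k; first by eexists; exact: vE.
exact: size_chain vE.
Qed.

Lemma image_wlim p q : 0 < p -> 1 < q -> image p q (wlim p q) (vlim p q).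
Proof.
move=> p_gt0 q_gt1; apply: (@image_limit _ _ (wword p q)) => m.
- apply: (@size_chain p q 1) => // k; exact: wwordE (ltnW q_gt1).
- exact: initial_wlim.
- exact: (initial_vlim m.+1).
Qed.

Lemma image_vlim p q : 0 < p -> 1 < q ->
  image p q (vlim p q) (prepend (nseq p A) (wlim p q)).
Proof.
move=> p_gt0 q_gt1; apply: (@image_limit _ _ (init_v p q)) => m.
- apply: (@size_chain p q 0) => // k; rewrite addn0; exact: init_vE (ltnW q_gt1).
- exact: initial_vlim.
- case: m => [|m]; rewrite ?phi1A ?wwordS ?(ltnW q_gt1) //.
    exact: initial_prepend (initial_wlim 0 p_gt0 q_gt1).
  exact: initial_prepend (initial_wlim m.+1 p_gt0 q_gt1).
Qed.

(** The letter B ends the prefix [phi(A)] of [ubeta]; applying [phi^2] and dropping the leading A's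
    preserves factors. *)
Lemma factor_wword p q m : 0 < p -> 0 < q -> factor (ubeta p q) (wword p q m).
Proof.
move=> p_gt0 q_gt0; have uu := image_ubeta p_gt0 q_gt0.
elim: m => [|m IH]; last first.
  by apply: (@factor_catr _ (nseq p A)); rewrite -wwordS //; do 2!apply: (factor_phi uu).
apply/factorP; exists (nseq p A); rewrite -(phi1A p q).
exact: (ubeta_prefix p_gt0 q_gt0 1).
Qed.

Lemma factor_wlim p q n : 0 < p -> 1 < q ->
  factor (ubeta p q) (mkseq (wlim p q) n).
Proof.
move=> p_gt0 q_gt1; have wE k := wwordE p k (ltnW q_gt1).
have sz : n < size (wword p q n) by exact: size_chain wE.
rewrite (initial_mkseq (initial_wlim n p_gt0 q_gt1) (ltnW sz)).
apply: (@factor_catl _ _ (drop n (wword p q n))); rewrite cat_take_drop.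
exact: factor_wword (ltnW q_gt1).
Qed.

Lemma factor_vlim p q n : 0 < p -> 1 < q ->
  factor (ubeta p q) (mkseq (vlim p q) n).
Proof.
move=> p_gt0 q_gt1; have q_gt0 := ltnW q_gt1.
have : n < size (phi p q (mkseq (wlim p q) n.+1)).
  by rewrite size_phi -/(cA _ _) -/(cB _ _); have := cAB (wlim p q) n.+1; nia.
move=> /ltnW /(initial_mkseq (image_wlim p_gt0 q_gt1 n.+1)) ->.
apply: (@factor_catl _ _ (drop n (phi p q (mkseq (wlim p q) n.+1)))).
rewrite cat_take_drop; apply: factor_phi; first exact: image_ubeta.
exact: factor_wlim.
Qed.

(** * The range of the number of B's *)

Lemma discrete_ivt (c : nat -> nat) b i j :
    (forall k, c k.+1 <= c k + 1 /\ c k <= c k.+1 + 1) ->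
  c i <= b <= c j -> exists k, c k = b.
Proof.
move=> c_step.
(* The disjunction covers a rise and a fall, so the walk can start at the left end whichever of [i]
   and [j] that is. *)
have between d k : (c k <= b <= c (k + d)) || (c (k + d) <= b <= c k) ->
    exists k', c k' = b.
  elim: d k => [|d IH] k; first by rewrite addn0 => bk; exists k; lia.
  have [<-|ne] := eqVneq (c k) b; first by exists k.
  by rewrite -addSnnS => bk; apply: (IH k.+1); have := c_step k; lia.
move=> bij; have [ij|/ltnW ji] := leqP i j.
  by apply: (between (j - i) i); rewrite subnKC // bij.
by apply: (between (i - j) j); rewrite subnKC // bij orbT.
Qed.

Lemma parikh_mkseq f n : parikh (mkseq f n) = (n - cB f n, cB f n).
Proof. by rewrite -[X in X - _](cAB f n) addnK. Qed.

(** At fixed length the number of B's determines the Parikh vector, and over sliding windows it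
    takes every value from [lo] to [hi]. *)
Lemma abelian_complexity_range u n lo hi :
    (exists2 w, factor u w & size w = n /\ count_mem B w = lo) ->
    (exists2 w, factor u w & size w = n /\ count_mem B w = hi) ->
    (forall i, lo <= cB (fun j => u (i + j)) n <= hi) ->
  abelian_complexity u n = (hi - lo).+1.
Proof.
pose c i := cB (fun j => u (i + j)) n.
move=> [w0 [i0 w0E] [sz0 w0_lo]] [w1 [i1 w1E] [sz1 w1_hi]] bounds.
have ci0 : c i0 = lo by rewrite -w0_lo w0E sz0.
have ci1 : c i1 = hi by rewrite -w1_hi w1E sz1.
have c_step k : c k.+1 <= c k + 1 /\ c k <= c k.+1 + 1.
  (* The window of [n + 1] letters from [k] on is split at its left end and at its right end. *)
  have e : cB (fun j => u (k + j)) 1 + c k.+1 = c k + ~~ is_A (u (k + n)).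
    rewrite -[RHS](cBS (fun j => u (k + j))) -[n.+1]add1n cB_addn; congr (_ + _).
    by congr (count _ _); apply: eq_mkseq => j; rewrite addSnnS.
  have := cAB (fun j => u (k + j)) 1; lia.
have lohi : lo <= hi by have /andP[] := bounds 0; exact: leq_trans.
pose s := [seq (n - b, b) | b <- iota lo (hi - lo).+1].
have sE : fset_set (parikh_factors u n) =i s.
  move=> ab; rewrite in_fset_set; last exact: finite_parikh_factors.
  apply/idP/idP => [|/mapP[b b_in ->]].
    rewrite inE => -[w [[i wE] sz] <-]; rewrite {}wE {}sz.
    apply/mapP; exists (c i).
      by rewrite mem_iota; have := bounds i; rewrite -/(c i); lia.
    by rewrite parikh_mkseq.
  have [k ck] : exists k, c k = b.
    apply: (discrete_ivt (i := i0) (j := i1) c_step).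
    by move: b_in; rewrite mem_iota addnS ltnS subnKC // ci0 ci1.
  rewrite inE; exists (mkseq (fun j => u (k + j)) n).
    by split; [exists k; rewrite size_mkseq | rewrite size_mkseq].
  by rewrite parikh_mkseq -/(c k) ck.
have s_uniq : uniq s by rewrite map_inj_uniq ?iota_uniq // => a b [].
rewrite /abelian_complexity -(size_iota lo (hi - lo).+1).
rewrite -(size_map (fun b => (n - b, b))).
by apply: perm_size; apply: uniq_perm.
Qed.

Lemma abelian_complexity_ubeta p q n : 1 < q -> q <= p ->
  cB (vlim p q) n <= cB (wlim p q) n /\
  abelian_complexity (ubeta p q) n = (cB (wlim p q) n - cB (vlim p q) n).+1.
Proof.
move=> q_gt1 qp; have q_gt0 := ltnW q_gt1; have p_gt0 : 0 < p by lia.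
have bounds i : cB (vlim p q) n <= cB (fun j => ubeta p q (i + j)) n
    <= cB (wlim p q) n.
  have := cB_factor_bounds q_gt1 qp (image_ubeta p_gt0 q_gt0)
    (image_wlim p_gt0 q_gt1) (image_vlim p_gt0 q_gt1) erefl erefl n i.
  by rewrite cB_addn !leq_add2l.
split; first by have /andP[+ +] := bounds 0; exact: leq_trans.
apply: abelian_complexity_range => //.
  by exists (mkseq (vlim p q) n); [exact: factor_vlim | rewrite size_mkseq].
by exists (mkseq (wlim p q) n); [exact: factor_wlim | rewrite size_mkseq].
Qed.

(** * Evaluation by U-representations *)

(** This keeps the greedy digits at most [p], as [mkseq_ubeta] requires. *)
Lemma U_leq p q k : q <= p -> U p q k.+1 <= p.+1 * U p q k.
Proof.
move=> qp; case: k => [|k]; first by rewrite U1 U0 muln1.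
rewrite U_rec mulSn addnC leq_add2r.
case: k => [|k]; first by rewrite U1 U0 muln1; lia.
rewrite U_rec; apply: leq_trans (leq_addr _ _); exact: leq_mul.
Qed.

(** The prefix of length [x] is the product, by decreasing [i], of powers of [phi^i(A)] whose
    exponents are the greedy digits; [mkseq_ubeta] splits off the leading power. *)
Lemma cB_digits p q K x : 0 < q -> q <= p -> x < U p q K.+1 ->
  cB (ubeta p q) x =
    \sum_(i < K.+1) digit (U p q) K x i * count_mem B (phiA p q i).
Proof.
move=> q_gt0 qp; have p_gt0 : 0 < p by lia.
have cB_div k y : y < U p q k.+1 -> cB (ubeta p q) y =
    y %/ U p q k * count_mem B (phiA p q k) + cB (ubeta p q) (y %% U p q k).
  move=> yk; have Uk : 0 < U p q k by apply: leq_ltn_trans (U_gt p_gt0 q_gt0 k).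
  rewrite /cB {1}(divn_eq y (U p q k)) mkseq_ubeta ?ltn_pmod -?divn_eq //.
    by rewrite count_cat count_rep.
  by rewrite -ltnS ltn_divLR //; apply: leq_trans yk (U_leq k qp).
elim: K x => [|K IH] x xK; rewrite (cB_div _ _ xK).
  by rewrite big_ord1 /digit U0 modn1 /cB /= addn0.
rewrite big_ord_recr /= addnC {2}/digit subnn /=; congr (_ + _).
rewrite IH; last by rewrite ltn_pmod //; apply: leq_ltn_trans (U_gt p_gt0 q_gt0 _).
apply: eq_bigr => i _; rewrite /digit subSn -?[i <= K]ltnS ?ltn_ord //=.
congr (nth 0 (normal_rep _ _ _) _ * _).
by rewrite {2}(divn_eq x (U p q K.+1)) addKn.
Qed.

Lemma U_lt_lenw p q m : 1 < q -> U p q (2 * m + 1) < lenw p q m.+1.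
Proof.
move=> q_gt1; rewrite /lenw big_nat_recr //= add1n ltnS mulnDr.
by apply: leq_trans (leq_addl _ _); rewrite leq_pmull // subn_gt0.
Qed.

Lemma U_lt_lenv p q m : 1 < q -> U p q (2 * m) < lenv p q (Posz m).
Proof.
move=> q_gt1; rewrite /lenv big_nat_recr //= add1n ltnS mulnDr.
by apply: leq_trans (leq_addl _ _); rewrite leq_pmull // subn_gt0.
Qed.

(** With [lenw_indexN], this places [n] between consecutive lengths of the chain, as [mkseq_chain]
    needs. *)
Lemma lt_lenw_indexN p q n J : 1 < q -> q <= p -> n < U p q J.+1 ->
  n < lenw p q (indexN p q n J).+1.
Proof.
move=> q_gt1 qp nJ; have q_gt0 := ltnW q_gt1; have p_gt0 : 0 < p by lia.
have [k [JE|JE]] : exists k, J = 2 * k \/ J = (2 * k).+1.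
- by exists J./2; have := odd_double_half J; case: (odd J); lia.
- have -> : indexN p q n J = k by rewrite /indexN JE; case: ifP; lia.
  by apply: ltn_trans nJ _; rewrite JE -[(2 * k).+1]addn1; exact: U_lt_lenw.
have -> : indexN p q n J = if lenw p q k.+1 <= n then k.+1 else k.
  rewrite /indexN JE; have -> : odd (2 * k).+1 by lia.
  have -> : (2 * k).+2./2 = k.+1 by lia.
  by have -> : (2 * k).+1.-1./2 = k by lia.
case: ifP => [_|/negbT]; last by rewrite -ltnNge.
apply: ltn_trans nJ (ltn_trans _ (U_lt_lenw p _ q_gt1)).
by rewrite JE (_ : 2 * k.+1 + 1 = (2 * k).+3) ?U_lt //; lia.
Qed.

(** Passing to the natural number [m = M + 1] avoids the index -1: the word [v^(-1) = A] is
    [init_v p q 0]. *)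
Lemma indexM_init_v p q n J : 1 < q -> q <= p -> n < U p q J.+1 ->
  exists m, [/\ indexM p q n J = (m%:Z - 1)%R,
    lenv p q (indexM p q n J) = size (init_v p q m) &
    n < size (init_v p q m.+1)].
Proof.
move=> q_gt1 qp nJ; have q_gt0 := ltnW q_gt1; have p_gt0 : 0 < p by lia.
have lenvE m : lenv p q (m%:Z - 1)%R = size (init_v p q m).
  case: m => [|m]; first by rewrite /lenv /= muln0.
  by rewrite size_vword // -addn1 PoszD addrK.
suff [m ME nm] : exists2 m, indexM p q n J = (m%:Z - 1)%R &
    n < lenv p q (Posz m) by exists m; rewrite ME lenvE size_vword.
have [k [JE|JE]] : exists k, J = 2 * k \/ J = (2 * k).+1.
- by exists J./2; have := odd_double_half J; case: (odd J); lia.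
- have ME : indexM p q n J = (if (lenv p q (Posz k) <= n)%N then k%:Z else k%:Z - 1)%R.
    rewrite /indexM JE oddM /=.
    by have -> : (2 * k)./2 = k by lia.
  case: ifP ME => [_|/negbT lt] ->; last by exists k; rewrite // ltnNge.
  exists k.+1; first by rewrite -addn1 PoszD addrK.
  apply: ltn_trans nJ (ltn_trans _ (U_lt_lenv p _ q_gt1)).
  by rewrite JE (_ : 2 * k.+1 = (2 * k).+2) ?U_lt //; lia.
exists k.+1.
  rewrite /indexM JE; have -> : odd (2 * k).+1 by lia.
  have -> : (2 * k).+1.-1./2 = k by lia.
  by rewrite -addn1 PoszD addrK.
apply: ltn_trans nJ _; rewrite JE.
by have -> : (2 * k).+2 = 2 * k.+1 by [lia]; exact: U_lt_lenv.
Qed.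

(** * Matrix form of the letter counts *)

Local Open Scope ring_scope.

(** The upper right entry, named so that it can be registered as a linear form and distributed over
    matrix sums. *)
Definition entry_AB (X : 'M[rat]_2) : rat := (row2 1 0 *m X *m col2 0 1) 0 0.

Fact entry_AB_is_scalar : scalar entry_AB.
Proof.
by move=> a X Y; rewrite /entry_AB mulmxDr mulmxDl -scalemxAr -scalemxAl !mxE.
Qed.

HB.instance Definition _ :=
  GRing.isLinear.Build rat 'M[rat]_2 rat *%R entry_AB entry_AB_is_scalar.

(** The row [(1,0) M^m] is the Parikh vector of [phi^m(A)]. *)
Lemma entry_AB_Mphi p q m :
  entry_AB (Mphi p q ^+ m) = (count_mem B (phiA p q m))%:R.
Proof.
have rowE : row2 1 0 *m Mphi p q ^+ m =
    row2 (count_mem A (phiA p q m))%:R (count_mem B (phiA p q m))%:R.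
  elim: m => [|m IH]; first by rewrite expr0 mulmx1.
  rewrite exprSr mulmxA IH; apply/rowP => j; rewrite /phiA iterS !count_phi.
  rewrite !mxE !big_ord_recl big_ord0 !mxE /=.
  case: j => -[|[|//]] ? /=; rewrite addr0 ?mulr1 ?mulr0 ?addr0 //.
  by rewrite natrD !natrM; congr (_ + _); rewrite mulrC.
rewrite /entry_AB rowE !mxE !big_ord_recl big_ord0 !mxE /=.
by rewrite mulr0 mulr1 add0r addr0.
Qed.

(** Multiplication by [M + I] turns each summand into [M^(2i+2) - M^(2i)], and the sum
    telescopes. *)
Lemma Mphi_alternating_sum p q N : (q <= p)%N ->
  invmx (Mphi p q + 1%:M) *m (Mphi p q ^+ (2 * N) - 1%:M) =
    \sum_(0 <= i < N) (Mphi p q ^+ (2 * i + 1) - Mphi p q ^+ (2 * i)).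
Proof.
move=> qp; rewrite -[RHS](mulKmx (Mphi_add1_unit qp)); congr (_ *m _).
elim: N => [|N IH]; first by rewrite big_nil mulmx0 subrr.
rewrite big_nat_recr //= mulmxDr -IH -[_ *m (_ - _)]/(_ * _) mulrDl !mulrBr !mul1r.
rewrite -!exprS addn1 (_ : (2 * N.+1 = (2 * N).+2)%N); last by lia.
by rewrite subrKA [RHS]addrC subrKA.
Qed.

(** Hence the coefficient [M - N + 1] in the theorem, equal to [m - N], is 0 or 1. *)
Lemma indexM_indexN p q n J m : indexM p q n J = m%:Z - 1 ->
  m = indexN p q n J \/ m = (indexN p q n J).+1.
Proof.
have := odd_double_half J.
by rewrite /indexM /indexN; case: odd => /=; case: ifP => _; lia.
Qed.

Theorem theorem6p10 (p q n J : nat)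
    (q_gt1 : (1 < q)%N) (q_le_p : (q <= p)%N) (n_gt0 : (0 < n)%N)
    (UJ_n : (U p q J <= n)%N) (n_UJ1 : (n < U p q J.+1)%N) :
  let N : nat := indexN p q n J in
  let M : int := indexM p q n J in
  let c := digit (U p q) J (n - lenw p q N)%N in
  let d := digit (U p q) J (n - lenv p q M)%N in
  (abelian_complexity (ubeta p q) n)%:R =
    2 + (row2 1 0
         *m ((q%:R - 1) *:
               (invmx (Mphi p q + 1%:M) *m (Mphi p q ^+ (2 * N) - 1%:M)
                - (M - N%:Z + 1)%:~R *: Mphi p q ^+ (2 * N))
             + \sum_(i < J.+1) ((c i)%:R - (d i)%:R) *: Mphi p q ^+ i)
         *m col2 0 1) 0 0.
Proof.
move=> N M c d.
have q_gt0 := ltnW q_gt1; have p_gt0 : (0 < p)%N by lia.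
have wE k := wwordE p k q_gt0.
have vE k : init_v p q k.+1 = init_v p q k ++ rep (phiA p q (2 * k + 0)) (q - 1).
  by rewrite addn0; exact: init_vE.
have cBw : cB (wlim p q) n = (count_mem B (wword p q N) +
    \sum_(i < J.+1) c i * count_mem B (phiA p q i))%N.
  rewrite /cB (mkseq_chain q_gt0 q_le_p _ wE (m := N)).
  - rewrite count_cat size_wword // -/(cB _ _); congr (_ + _)%N; apply: cB_digits => //.
    exact: leq_ltn_trans (leq_subr _ _) n_UJ1.
  - by move=> m; exact: initial_wlim.
  - by rewrite !size_wword // lenw_indexN // lt_lenw_indexN.
have [m [ME lenME n_lt]] := indexM_init_v q_gt1 q_le_p n_UJ1.
have cBv : cB (vlim p q) n = (count_mem B (init_v p q m) +
    \sum_(i < J.+1) d i * count_mem B (phiA p q i))%N.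
  rewrite /cB (mkseq_chain q_gt0 q_le_p _ vE (m := m)).
  - rewrite count_cat -lenME -/(cB _ _); congr (_ + _)%N; apply: cB_digits => //.
    exact: leq_ltn_trans (leq_subr _ _) n_UJ1.
  - by move=> k; exact: initial_vlim.
  - by rewrite -lenME lenv_indexM.
have [le_vw ->] := abelian_complexity_ubeta n q_gt1 q_le_p.
pose b i : rat := (count_mem B (phiA p q i))%:R.
(* The sum for [v] has at most one summand beyond the first [N]; the coefficient [M - N + 1]
   switches it on. *)
have sum_even : \sum_(0 <= i < m) b (2 * i + 0)%N =
    \sum_(0 <= i < N) b (2 * i)%N + (M - N%:Z + 1)%:~R * b (2 * N)%N.
  rewrite (eq_bigr (fun i => b (2 * i)%N)) => [|i _]; last by rewrite addn0.
  have -> : M - N%:Z + 1 = m%:Z - N%:Z by rewrite /M ME; lia.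
  case: (indexM_indexN ME) => ->; first by rewrite subrr mul0r addr0.
  rewrite big_nat_recr //= -/N (_ : N.+1%:Z - N%:Z = 1) ?mul1r //; lia.
have digit_sum (e : nat -> nat) : (\sum_(i < J.+1) e i * count_mem B (phiA p q i))%:R =
    \sum_(i < J.+1) (e i)%:R * b i.
  by rewrite natr_sum; apply: eq_bigr => i _; rewrite natrM.
rewrite -addn1 natrD natrB // cBw cBv !natrD !digit_sum.
(* The initial words B and A contribute 1 and 0 to the difference; with the successor in the
   cardinality this makes the constant 2. *)
rewrite (count_chain _ _ wE) (count_chain _ _ vE) /= !natrD !natrM natrB // !natr_sum.
rewrite sum_even -/(entry_AB _) Mphi_alternating_sum //.
rewrite linearD linearZ linearB linearZ !linear_sum /= entry_AB_Mphi.
under [X in X - _ * _]eq_bigr => i _ do rewrite linearB /= !entry_AB_Mphi.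
under [X in _ = _ + (_ + X)]eq_bigr => i _ do
  rewrite linearZ /= entry_AB_Mphi mulrBl.
rewrite !sumrB -!/(b _).
ring.
Qed.
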